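(* Let $(\mathfrak{g},\alpha)$ and $(V,\beta)$ be vector spaces equipped with linear operators, and let $\mu:\wedge^2\mathfrak{g}\to\mathfrak{g}$ and $\rho:\mathfrak{g}\to\mathrm{End}(V)$ be linear maps. Then $\mu$ defines a hom-Lie algebra structure on the pair $(\mathfrak{g},\alpha)$ and $\rho$ defines a representation of this hom-Lie algebra on the pair $(V,\beta)$ if and only if $\mu+\rho$ is a Maurer-Cartan element of the graded Lie algebra $\big(\mathcal{G}^*,[\cdot,\cdot]_N^{\alpha+\beta}\big)$, i.e. $\mu+\rho\in\mathcal{G}^1$ and $[\mu+\rho,\mu+\rho]_N^{\alpha+\beta}=0$.
   Context: The base field $k$ has characteristic zero. A (multiplicative) hom-Lie algebra $(\mathfrak{g},[\cdot,\cdot],\alpha)$ is a vector space $\mathfrak{g}$ with a skew-symmetric bilinear bracket and a linear map $\alpha:\mathfrak{g}\to\mathfrak{g}$ with $\alpha[x,y]=[\alpha(x),\alpha(y)]$ and $[\alpha(x),[y,z]]+[\alpha(y),[z,x]]+[\alpha(z),[x,y]]=0$ for all $x,y,z$. A representation on $V$ with respect to $\beta\in\mathrm{End}(V)$ is a linear map $\rho:\mathfrak{g}\to\mathrm{End}(V)$ with $\rho(\alpha(x))(\beta(v))=\beta(\rho(x)(v))$ and $\rho([x,y])(\beta(v))=\rho(\alpha(x))\rho(y)(v)-\rho(\alpha(y))\rho(x)(v)$. For a vector space $W$ with a linear map $\gamma:W\to W$, let $C^n_\gamma(W,W)$ ($n\ge1$) be the space of linear maps $f:\wedge^nW\to W$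 with $f(\gamma(x_1),\dots,\gamma(x_n))=\gamma(f(x_1,\dots,x_n))$. For $\varphi\in C^{p+1}_\gamma(W,W)$, $\psi\in C^{q+1}_\gamma(W,W)$ set $$(\varphi\circ_\gamma\psi)(x_1,\dots,x_{p+q+1})=\sum_{\tau\in Sh(q+1,p)}(-1)^{|\tau|}\varphi\big(\psi(x_{\tau(1)},\dots,x_{\tau(q+1)}),\gamma^q(x_{\tau(q+2)}),\dots,\gamma^q(x_{\tau(p+q+1)})\big),$$ where $Sh(q+1,p)$ is the set of $(q+1,p)$-shuffles in $S_{p+q+1}$ and $(-1)^{|\tau|}$ is the sign of $\tau$, and $$[\varphi,\psi]_N^\gamma=(-1)^{pq}\varphi\circ_\gamma\psi-\psi\circ_\gamma\varphi.$$ This makes the space with $C^{p+1}_\gamma(W,W)$ in degree $p$ a graded Lie algebra. Take $W=\mathfrak{g}\oplus V$ and $\gamma=\alpha+\beta$, where $(\alpha+\beta)(x+v)=\alpha(x)+\beta(v)$, and let $\mathcal{G}^p=C^{p+1}_{\alpha+\beta}(\mathfrak{g}\oplus V,\mathfrak{g}\oplus V)$. The map $\mu+\rho:\wedge^2(\mathfrak{g}\oplus V)\to\mathfrak{g}\oplus V$ is $(\mu+\rho)(x+v,y+w)=\mu(x,y)+\rho(x)(w)-\rho(y)(v)$ for $x,y\in\mathfrak{g}$, $v,w\in V$. *)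

(* Defs.v *)
From HB Require Import structures.
From mathcomp Require Import all_boot all_order all_fingroup all_algebra.

Set Implicit Arguments.
Unset Strict Implicit.
Unset Printing Implicit Defensive.

Import GRing.Theory.
Local Open Scope ring_scope.

Section HomLie.
Variables (k : fieldType) (g V : lmodType k).

(* A linear map out of the exterior square of [g] is an alternating bilinear
   map. *)
Definition alternating_bilinear (mu : {bilinear g -> g -> g}) : Prop :=
  forall x, mu x x = 0.

Record is_hom_lie (alpha : {linear g -> g}) (mu : {bilinear g -> g -> g}) :
    Prop := IsHomLie {
  hom_lie_skew : forall x y, mu x y = - mu y x;
  hom_lie_mult : forall x y, alpha (mu x y) = mu (alpha x) (alpha y);
  hom_lie_jacobi : forall x y z,
    mu (alpha x) (mu y z) + mu (alpha y) (mu z x) + mu (alpha z) (mu x y) = 0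
}.

(* A linear map [g -> End(V)] is given in uncurried form, as a bilinear map. *)
Record is_hom_lie_rep (alpha : {linear g -> g}) (mu : {bilinear g -> g -> g})
    (beta : {linear V -> V}) (rho : {bilinear g -> V -> V}) :
    Prop := IsHomLieRep {
  hom_lie_rep_mult : forall x v, rho (alpha x) (beta v) = beta (rho x v);
  hom_lie_rep_bracket : forall x y v,
    rho (mu x y) (beta v) =
      rho (alpha x) (rho y v) - rho (alpha y) (rho x v)
}.

Definition dsum_map (alpha : {linear g -> g}) (beta : {linear V -> V})
    (a : g * V) : g * V := (alpha a.1, beta a.2).

Fact dsum_map_linear alpha beta : linear (dsum_map alpha beta).
Proof. by move=> c [x v] [y w]; rewrite /dsum_map /= !linearP. Qed.

HB.instance Definition _ (alpha : {linear g -> g}) (beta : {linear V -> V}) :=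
  GRing.isLinear.Build k (g * V)%type (g * V)%type *:%R (dsum_map alpha beta)
    (dsum_map_linear alpha beta).

(* The map [mu + rho], with its two arguments packed as in [multimap] below. *)
Definition dsum_bracket (mu : {bilinear g -> g -> g})
    (rho : {bilinear g -> V -> V}) (z : {ffun 'I_2 -> g * V}) : g * V :=
  let a := z ord0 in let b := z ord_max in
  (mu a.1 b.1, rho a.1 b.2 - rho b.1 a.2).

End HomLie.

Section NijenhuisRichardson.
Variables (k : fieldType) (W : lmodType k).

Definition multimap (n : nat) : Type := {ffun 'I_n -> W} -> W.

Definition ffupd n (x : {ffun 'I_n -> W}) (i : 'I_n) (u : W) :
  {ffun 'I_n -> W} := [ffun j => if j == i then u else x j].

Definition multilinear n (f : multimap n) : Prop :=
  forall (x : {ffun 'I_n -> W}) (i : 'I_n) (c : k) (u v : W),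
    f (ffupd x i (c *: u + v)) = c *: f (ffupd x i u) + f (ffupd x i v).

Definition alternating n (f : multimap n) : Prop :=
  forall (x : {ffun 'I_n -> W}) (i j : 'I_n), i != j -> x i = x j -> f x = 0.

(* Membership in C^n_gamma(W, W): linear maps out of the n-th exterior power
   are alternating multilinear maps. *)
Record is_cochain (gamma : {linear W -> W}) n (f : multimap n) :
    Prop := IsCochain {
  cochain_multilinear : multilinear f;
  cochain_alternating : alternating f;
  cochain_comm : forall x : {ffun 'I_n -> W},
    f [ffun i => gamma (x i)] = gamma (f x)
}.

Definition is_shuffle m n (t : 'S_(m + n)) : bool :=
  [forall i : 'I_m, forall j : 'I_m,
     (i < j)%N ==> (t (lshift n i) < t (lshift n j))%N] &&
  [forall i : 'I_n, forall j : 'I_n,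
     (i < j)%N ==> (t (rshift m i) < t (rshift m j))%N].

(* The arity p + q + 1 is written (q + 1) + p, so that [lshift] and [rshift]
   index the two blocks of a (q + 1, p)-shuffle. *)
Definition circ (gamma : {linear W -> W}) p q
    (phi : multimap p.+1) (psi : multimap q.+1) : multimap (q.+1 + p) :=
  fun x =>
    \sum_(t : 'S_(q.+1 + p) | is_shuffle t)
      (-1) ^+ odd_perm t *:
        phi [ffun i : 'I_p.+1 =>
               if unlift ord0 i is Some j
               then iter q gamma (x (t (rshift q.+1 j)))
               else psi [ffun l : 'I_q.+1 => x (t (lshift p l))]].

(* [p.+1 + q] is convertible to [(p + q).+1]; only the first term needs its
   arguments reindexed. *)
Definition nr_bracket (gamma : {linear W -> W}) p q
    (phi : multimap p.+1) (psi : multimap q.+1) : multimap (p + q).+1 :=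
  fun x =>
    (-1) ^+ (p * q) *:
      circ gamma phi psi [ffun i => x (cast_ord (congr1 S (addnC q p)) i)]
    - circ gamma psi phi x.

(* Maurer-Cartan elements lie in degree 1, that is, in C^2_gamma(W, W); the
   graded Lie algebra has no differential. *)
Definition is_maurer_cartan (gamma : {linear W -> W}) (theta : multimap 2) :
    Prop :=
  is_cochain gamma theta /\
  forall x, @nr_bracket gamma 1 1 theta theta x = 0.

End NijenhuisRichardson.

(* Main.v *)
(** In characteristic zero the bracket [[theta, theta]] of a degree 1 element
    is [- 2] times [theta o theta], and the three (2, 1)-shuffles turn
    [theta o theta = 0] into the hom-Jacobi identity for [theta] on the direct
    sum. Its [g]-component is the hom-Jacobi identity of [mu]; its
    [V]-component is a sum of three instances of the bracket axiom of [rho],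
    and reduces to one of them on arguments [(x, 0)], [(y, 0)], [(0, v)].
    Commutation with [alpha + beta] splits into components in the same way. *)

Require Import Defs.
From HB Require Import structures.
From mathcomp Require Import all_boot all_order all_fingroup all_algebra.

Set Implicit Arguments.
Unset Strict Implicit.
Unset Printing Implicit Defensive.

Import GRing.Theory.
Local Open Scope ring_scope.

Section BinaryCirc.
Variables (k : fieldType) (W : lmodType k).

Definition pack2 (a b : W) : {ffun 'I_2 -> W} :=
  [ffun i : 'I_2 => if i == ord0 then a else b].

Lemma lshift21E (i : 'I_2) : lshift 1 i = lift (ord_max : 'I_3) i.
Proof. by apply: val_inj; rewrite /= /bump leqNgt ltn_ord. Qed.

Lemma rshift21E (i : 'I_1) : rshift 2 i = ord_max :> 'I_3.
Proof. by apply: val_inj; rewrite ord1. Qed.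

(** A (2, 1)-shuffle is determined by the image of its last index: the first two indices must go
    increasingly onto the complement, as [lift_perm ord_max _ 1] sends them. With
    [lift_perm_shuffle21], this makes [t ord_max] a parameter over which the sum in [circ] can be
    reindexed. *)
Lemma shuffle21_lift_perm (t : 'S_(2 + 1)) :
  is_shuffle t -> lift_perm ord_max (t ord_max) 1 = t.
Proof.
case/andP=> /forallP/(_ ord0)/forallP/(_ ord_max)/= lt01 _.
rewrite !lshift21E in lt01.
have ne_max (i : 'I_2) : t (lift ord_max i) != t ord_max.
  by rewrite (inj_eq perm_inj) eq_sym neq_lift.
apply/permP=> i; case: (unliftP ord_max i) => [j|] ->; last first.
  by rewrite lift_perm_id.
rewrite lift_perm_lift perm1; apply: val_inj => /=.
have [-> | ->] : j = ord0 \/ j = ord_max.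
  by case: j => [[|[|j]] lt_j2] //; [left | right]; apply: val_inj.
(* Once the three images are generalised, the claim is a finite check over triples in ['I_3]. *)
all: move: (ne_max ord0) (ne_max ord_max) lt01.
all: move: (t (lift ord_max ord0)) (t (lift ord_max ord_max)) (t ord_max).
all: by move=> [[|[|[|a]]] ?] [[|[|[|b]]] ?] [[|[|[|c]]] ?].
Qed.

Lemma lift_perm_shuffle21 (i : 'I_3) :
  @is_shuffle 2 1 (lift_perm ord_max i 1).
Proof.
apply/andP; split; apply/forallP=> a; apply/forallP=> b; apply/implyP=> ltab.
  rewrite !lshift21E !lift_perm_lift !perm1 /= /bump.
  by move: a b i ltab => [[|[|a]] ?] [[|[|b]] ?] [[|[|[|i]]] ?].
by move: ltab; rewrite !ord1.
Qed.

Lemma circ11E (gamma : {linear W -> W}) (phi psi : multimap W 2)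
    (x : {ffun 'I_3 -> W}) (x0 := x ord0) (x1 := x (lift ord0 ord0))
    (x2 := x ord_max) :
  @circ k W gamma 1 1 phi psi x =
    phi (pack2 (psi (pack2 x1 x2)) (gamma x0))
    - phi (pack2 (psi (pack2 x0 x2)) (gamma x1))
    + phi (pack2 (psi (pack2 x0 x1)) (gamma x2)).
Proof.
rewrite /circ (reindex_onto (fun i : 'I_3 => lift_perm ord_max i 1)
  (fun t : 'S_3 => t ord_max)) /=; last by move=> t /shuffle21_lift_perm.
rewrite (eq_bigl xpredT) => [|i]; last first.
  by rewrite lift_perm_shuffle21 lift_perm_id eqxx.
(* [lift i ord0] and [lift i ord_max] are the two indices other than [i], in increasing order. *)
have packE (i : 'I_3) :
    [ffun j : 'I_2 => if unlift ord0 j is Some l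
       then iter 1 gamma (x (lift_perm ord_max i 1 (rshift 2 l)))
       else psi [ffun l : 'I_2 => x (lift_perm ord_max i 1 (lshift 1 l))]]
    = pack2 (psi (pack2 (x (lift i ord0)) (x (lift i ord_max)))) (gamma (x i)).
  apply/ffunP=> j; rewrite !ffunE; case: unliftP => [l|] ->.
    by rewrite rshift21E lift_perm_id.
  rewrite eqxx; congr psi; apply/ffunP=> l; rewrite !ffunE.
  rewrite lshift21E lift_perm_lift perm1.
  by case: l => [[|[|l]] lt_l2] //=; congr (x _); apply: val_inj.
(* The parity of [lift_perm ord_max i 1] is that of [2 + i], hence the signs +, -, +. *)
under eq_bigr => i _ do rewrite packE odd_lift_perm odd_perm1 addbF /=.
rewrite !big_ord_recl big_ord0 addr0 /= !expr0 !expr1 !scale1r scaleN1r addrA.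
rewrite /x0 /x1 /x2; congr (phi (pack2 (psi (pack2 _ _)) _) -
  phi (pack2 (psi (pack2 _ _)) _) + phi (pack2 (psi (pack2 _ _)) (gamma _)));
by congr (x _); apply: val_inj.
Qed.

Lemma nr_bracket11_eq0 (chark0 : [pchar k] =i pred0) (gamma : {linear W -> W})
    (theta : multimap W 2) (x : {ffun 'I_3 -> W}) :
  @nr_bracket k W gamma 1 1 theta theta x = 0 <->
  @circ k W gamma 1 1 theta theta x = 0.
Proof.
(* For p = q = 1 the cast of indices preserves values, so both terms of the bracket are the same
   [circ], each with sign -1. *)
rewrite /nr_bracket (_ : [ffun i => _] = x); last first.
  by apply/ffunP=> i; rewrite ffunE; congr (x _); apply: val_inj.
rewrite expr1 scaleN1r -opprD -mulr2n -scaler_nat; split=> [|->].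
  move/eqP; rewrite oppr_eq0 scaler_eq0 => /orP[|/eqP //].
  by rewrite ((pcharf0P k).1 chark0).
by rewrite scaler0 oppr0.
Qed.

End BinaryCirc.

Section DirectSum.
Variables (k : fieldType) (g V : lmodType k).
Variables (mu : {bilinear g -> g -> g}) (mu_alt : alternating_bilinear mu).
Variable rho : {bilinear g -> V -> V}.

Lemma alternating_bilinear_skew x y : mu x y = - mu y x.
Proof.
apply/eqP; rewrite -addr_eq0; have := mu_alt (x + y).
by rewrite linearDl !linearDr !mu_alt /= add0r addr0 => ->.
Qed.

Lemma dsum_bracket_pack2 (a b : g * V) :
  dsum_bracket mu rho (pack2 a b)
  = (mu a.1 b.1, rho a.1 b.2 - rho b.1 a.2).
Proof. by rewrite /dsum_bracket !ffunE. Qed.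

Lemma dsum_bracket_multilinear : multilinear (dsum_bracket mu rho).
Proof.
move=> x i c u v; rewrite /dsum_bracket !ffunE.
have [-> | ->] : i = ord0 \/ i = ord_max.
- by case: i => [[|[|i]] lt_i2] //; [left | right]; apply: val_inj.
- rewrite eqxx /=; congr pair; rewrite ?linearPl ?linearPr //=.
  by rewrite scalerBr opprD addrACA.
rewrite eqxx /=; congr pair; rewrite ?linearPl ?linearPr //=.
by rewrite scalerBr opprD addrACA.
Qed.

Lemma dsum_bracket_alternating : alternating (dsum_bracket mu rho).
Proof.
move=> x i j ne_ij eq_x.
have eq01 : x ord0 = x ord_max.
  move: i j ne_ij eq_x => [[|[|i]] ?] [[|[|j]] ?] //= _ eq_x; [|symmetry];
  by apply: etrans (etrans eq_x _); congr (x _); apply: val_inj.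
by rewrite /dsum_bracket eq01 mu_alt subrr.
Qed.

End DirectSum.

Theorem proposition2p9 (k : fieldType) (chark0 : [pchar k] =i pred0)
    (g V : lmodType k) (alpha : {linear g -> g}) (beta : {linear V -> V})
    (mu : {bilinear g -> g -> g}) (mu_alt : alternating_bilinear mu)
    (rho : {bilinear g -> V -> V}) :
  (is_hom_lie alpha mu /\ is_hom_lie_rep alpha mu beta rho) <->
  is_maurer_cartan (dsum_map alpha beta) (dsum_bracket mu rho).
Proof.
have skew := alternating_bilinear_skew mu_alt.
have jacE x y z :
    mu (mu y z) (alpha x) - mu (mu x z) (alpha y) + mu (mu x y) (alpha z)
    = - (mu (alpha x) (mu y z) + mu (alpha y) (mu z x)
         + mu (alpha z) (mu x y)).
  rewrite (skew _ (alpha x)) (skew _ (alpha y)) (skew _ (alpha z)) (skew x z).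
  by rewrite linearNr /= opprK -!opprD.
split=> [[[_ muM jac] [rhoM rhoB]] | [[_ _ comm] mc]].
  split.
    split; [exact: dsum_bracket_multilinear | exact: dsum_bracket_alternating|].
    move=> x; rewrite /dsum_bracket !ffunE /= /dsum_map /= muM !rhoM.
    by rewrite linearB.
  move=> x; apply/(nr_bracket11_eq0 chark0); rewrite circ11E.
  move: (x ord0) (x (lift ord0 ord0)) (x ord_max).
  move=> [x0 v0] [x1 v1] [x2 v2]; rewrite !dsum_bracket_pack2 /=; congr pair.
    by rewrite jacE jac oppr0.
  rewrite !linearBr !rhoB /=.
  (* Each summand now has four terms of the form rho(alpha x_i) rho(x_j) v_l. The middle summand
     moves to the right; on the left two pairs cancel, leaving exactly its four terms. *)
  rewrite addrAC; apply/eqP; rewrite subr_eq0 !opprB; apply/eqP.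
  rewrite [X in _ + X]addrC addrACA !subrKA addrACA.
  by rewrite [X in X + _]addrC addrACA.
have mcP (a b c : g * V) :
    let br u v := (mu u.1 v.1, rho u.1 v.2 - rho v.1 u.2) in
    br (br b c) (dsum_map alpha beta a) - br (br a c) (dsum_map alpha beta b)
    + br (br a b) (dsum_map alpha beta c) = 0.
  have := mc [ffun i : 'I_3 => nth 0 [:: a; b; c] i].
  by move/(nr_bracket11_eq0 chark0); rewrite circ11E !ffunE !dsum_bracket_pack2.
have commP (a b : g * V) := comm (pack2 a b).
split; split.
- exact: skew.
- move=> x y; have /(congr1 fst) := commP (x, 0) (y, 0).
  by rewrite /dsum_bracket !ffunE.
- move=> x y z; have /(congr1 fst)/= := mcP (x, 0) (y, 0) (z, 0).
  by rewrite jacE => /eqP; rewrite oppr_eq0 => /eqP.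
- move=> x v; have /(congr1 snd) := commP (x, 0) (0, v).
  by rewrite /dsum_bracket !ffunE /= (linear0 alpha) linear0r linear0l !subr0.
(* Only one term of each summand survives: - rho(alpha x) rho(y) v, rho(alpha y) rho(x) v and rho(mu
   x y)(beta v). *)
move=> x y v; have /(congr1 snd)/= := mcP (x, 0) (y, 0) (0, v).
rewrite (linear0 alpha) (linear0 beta) !linear0r linear0l !subr0 !sub0r opprK.
by rewrite addrC => /eqP; rewrite addr_eq0 opprD opprK => /eqP.
Qed.
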